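(* Every dominating function $h$ uniformly computes a maximal independent family of computable sets; in other words, $\mathcal{I}\le_s\mathrm{DomFcn}$.
   Context: For sets $A,B\subseteq\omega$, $A\subseteq^* B$ means $A\setminus B$ is finite; $\overline{R}=\omega\setminus R$. With $\langle\cdot,\cdot\rangle$ the usual computable Cantor pairing function on $\omega$, a set $X\subseteq\omega$ encodes the sequence $(X_n)_{n\in\omega}$ of its columns $X_n=\{u:\langle u,n\rangle\in X\}$. Given a sequence $(F_n)_{n\in\omega}$ of sets, let $F_{\emptyset}=\omega$ for the empty string, and for each nonempty finite binary string $\sigma$ let $F_\sigma=\bigcap_{\sigma(i)=1}F_i\cap\bigcap_{\sigma(i)=0}\overline{F_i}$ (where $i<|\sigma|$). The sequence is independent if each $F_\sigma$ is infinite. A sequence of computable sets is maximal independent (for the Boolean algebra of computable sets) if it is independent and for each computable set $R$ there is $\sigma$ such that $F_\sigma\subseteq^* R$ or $F_\sigma\subseteq^*\overline{R}$. $\mathcal{I}$ is the class of sets $F$ encoding a maximal independent sequence of computable sets. For $f,g\colon\omega\to\omega$, $g$ dominates $f$ if $g(n)\ge f(n)$ for all sufficiently large $n$. $\mathrm{DomFcn}$ is the class of functions $h\colon\omega\to\omega$ that dominate every computable function and satisfy $h(s)\ge s$ for all $s$. Medvedev reducibility between classes of functions on $\omega$ (sets are identified with characteristic functions): $\mathcal{C}\le_s\mathcal{D}$ if there is a Turing functional $\Theta$ such that $\Theta^g\in\mathcal{C}$ for each $g\in\mathcal{D}$. *)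

(* Defs.v *)
From Stdlib Require Cantor.
From mathcomp Require Import all_boot.
From mathcomp Require Import boolp classical_sets cardinality.

Set Implicit Arguments.
Unset Strict Implicit.
Unset Printing Implicit Defensive.

Local Open Scope classical_set_scope.

Definition cpair (x y : nat) : nat := Cantor.to_nat (x, y).
Definition cfst (z : nat) : nat := (Cantor.of_nat z).1.
Definition csnd (z : nat) : nat := (Cantor.of_nat z).2.

(* Programs for the partial recursive functions relative to an oracle, as unary
   functions; further arguments are passed through the Cantor pairing.
   Each program is a Turing functional. *)
Inductive prog : Type :=
| Zero
| Succ
| Fst
| Snd
| Oracle
| Pair of prog & prog
| Comp of prog & prog
| Prec of prog & prog
| Mu of prog.

(* [eval g p x y]: the program [p] with oracle [g] halts on input [x] with
   output [y]. *)
Inductive eval (g : nat -> nat) : prog -> nat -> nat -> Prop :=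
| eval_zero x : eval g Zero x 0
| eval_succ x : eval g Succ x x.+1
| eval_fst x : eval g Fst x (cfst x)
| eval_snd x : eval g Snd x (csnd x)
| eval_oracle x : eval g Oracle x (g x)
| eval_pair p q x a b :
    eval g p x a -> eval g q x b -> eval g (Pair p q) x (cpair a b)
| eval_comp p q x z y :
    eval g q x z -> eval g p z y -> eval g (Comp p q) x y
| eval_prec0 p q a y :
    eval g p a y -> eval g (Prec p q) (cpair a 0) y
| eval_precS p q a n z y :
    eval g (Prec p q) (cpair a n) z ->
    eval g q (cpair a (cpair n z)) y ->
    eval g (Prec p q) (cpair a n.+1) y
  (* The values below [n] must be defined and nonzero; [v] lists their
     predecessors. *)
| eval_mu p a n (v : nat -> nat) :
    (forall m, m < n -> eval g p (cpair a m) (v m).+1) ->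
    eval g p (cpair a n) 0 ->
    eval g (Mu p) a n.

Definition computes (g : nat -> nat) (p : prog) (f : nat -> nat) : Prop :=
  forall x, eval g p x (f x).

(* The constant zero oracle is the empty set. *)
Definition computable (f : nat -> nat) : Prop :=
  exists p, computes (fun=> 0) p f.

Definition charfun (A : set nat) : nat -> nat := fun x => nat_of_bool (x \in A).

Definition computable_set (A : set nat) : Prop := computable (charfun A).

Definition almost_subset (A B : set nat) : Prop := finite_set (A `\` B).

Definition column (X : set nat) (n : nat) : set nat :=
  [set u | X (cpair u n)].

Definition Fstr (F : nat -> set nat) (s : seq bool) : set nat :=
  \bigcap_(i in [set i : nat | i < size s])
    (if nth false s i then F i else ~` F i).

Definition independent (F : nat -> set nat) : Prop :=
  forall s : seq bool, infinite_set (Fstr F s).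

(* Maximality is relative to the Boolean algebra of computable sets. *)
Definition maximal_independent (F : nat -> set nat) : Prop :=
  independent F /\
  forall R : set nat, computable_set R ->
    exists s : seq bool,
      almost_subset (Fstr F s) R \/ almost_subset (Fstr F s) (~` R).

Definition encodes_MIS (X : set nat) : Prop :=
  (forall n, computable_set (column X n)) /\ maximal_independent (column X).

Definition I_class : set (nat -> nat) := charfun @` [set X | encodes_MIS X].

Definition dominates (g f : nat -> nat) : Prop :=
  exists N, forall n, N <= n -> f n <= g n.

Definition DomFcn : set (nat -> nat) :=
  [set h | (forall f, computable f -> dominates h f) /\ forall s, s <= h s].

Definition medvedev_le (C D : set (nat -> nat)) : Prop :=
  exists Theta : prog, forall g, D g -> exists f, computes g Theta f /\ C f.

(* Main.v *)
From Stdlib Require Cantor.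
From mathcomp Require Import all_boot.
From mathcomp Require Import boolp classical_sets cardinality.
Require Import Defs.

(** Why the theorem holds.

If the oracle could decide everything about computable sets, a maximal
independent sequence would be built greedily.  Let [R_0, R_1, ...] list the
computable sets and suppose that [F_0, ..., F_{e-1}] are independent.  If [R_e]
meets each of their [2 ^ e] atoms in an infinite and coinfinite part, put
[F_e = R_e]: then the atom where only [F_e] is taken positively lies inside
[R_e].  Otherwise some atom is almost contained in [R_e] or in its complement,
so [R_e] is already decided, and [F_e] may be any computable set that splits all
atoms; the set of those [x] preceded by an odd number of elements of their own
atom is one.

A function [h] that dominates the computable functions replaces the decisions.
Write [phi_e] for the [e]-th partial computable function with values 0 and 1.
That [phi_e] is total and splits all atoms means that a search started at [y]
(for the values up to [y], and for witnesses above [y] in all parts of all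
atoms) always succeeds. If so, its running time is a computable function of [y]
and [h y] is at least as large for almost all [y]; if not, the search fails for
almost all [y], whatever time it is given. Hence the bounded test [test (atom h
e) e y (h y)] gives the same answer for almost all [y]. To decide [x] in [F_e],
this test is run for the last [y] with [h y <= x]. Thus [F_e] is almost equal
either to [R_e] or to the parity set, according to which of the two cases really
holds ([atom_split], [atom_parity]); a finite error affects neither
computability ([computable_atom]) nor independence ([atom_infinite]) nor
maximality ([family_encodes]). Since [h y <= x], the test looks at the earlier
sets only up to [x], so the whole family is computed from [h] by a recursion on
tables ([rec_table], [rec_atom]).

The enumeration of partial functions comes from a closure process ([stage]): at
each stage the rules defining the evaluation relation are applied to a finite
part of the facts known so far. This process is computable, finds every
computation ([known_complete]), and never assigns two values to one argument
([stage_deterministic]). *)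

Set Implicit Arguments.
Unset Strict Implicit.
Unset Printing Implicit Defensive.

Local Open Scope classical_set_scope.

(** * Functions computed uniformly in a family of oracles *)

Lemma cfstK x y : cfst (cpair x y) = x.
Proof. by rewrite /cfst /cpair Cantor.cancel_of_to. Qed.

Lemma csndK x y : csnd (cpair x y) = y.
Proof. by rewrite /csnd /cpair Cantor.cancel_of_to. Qed.

Lemma cpairK z : cpair (cfst z) (csnd z) = z.
Proof.
by rewrite /cpair /cfst /csnd -surjective_pairing Cantor.cancel_to_of.
Qed.

Opaque cpair cfst csnd.

(** One program serves all indices.  Functionals of an oracle [h] are the case
[o = id], and computability without oracle is the case of a one-element index
type with the zero oracle, so both share the closure lemmas below. *)
Definition recursive (I : Type) (o f : I -> nat -> nat) : Prop :=
  exists p, forall i, computes (o i) p (f i).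

Section Closure.
Variables (I : Type) (o : I -> nat -> nat).
Local Notation rec := (recursive o).

Lemma rec_ext f g : (forall i x, f i x = g i x) -> rec f -> rec g.
Proof. by move=> fg [p pf]; exists p => i x; rewrite -fg; exact: (pf i x). Qed.

Lemma rec_comp f a : rec f -> rec a -> rec (fun i x => f i (a i x)).
Proof.
move=> [p pf] [q qa]; exists (Comp p q) => i x.
exact: eval_comp (qa i x) (pf i _).
Qed.

Lemma rec_oracle a : rec a -> rec (fun i x => o i (a i x)).
Proof. by apply: rec_comp; exists Oracle => i x; apply: eval_oracle. Qed.

Lemma rec_id : rec (fun _ x => x).
Proof.
exists (Pair Fst Snd) => i x; rewrite -[X in eval _ _ _ X](cpairK x).
by apply: eval_pair; constructor.
Qed.

Lemma rec_cfst a : rec a -> rec (fun i x => cfst (a i x)).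
Proof.
by apply: (@rec_comp (fun _ => cfst)); exists Fst => i x; constructor.
Qed.

Lemma rec_csnd a : rec a -> rec (fun i x => csnd (a i x)).
Proof.
by apply: (@rec_comp (fun _ => csnd)); exists Snd => i x; constructor.
Qed.

Lemma rec_succ a : rec a -> rec (fun i x => (a i x).+1).
Proof.
by apply: (@rec_comp (fun _ => succn)); exists Succ => i x; constructor.
Qed.

Lemma rec_cpair a b : rec a -> rec b -> rec (fun i x => cpair (a i x) (b i x)).
Proof.
move=> [p pa] [q qb]; exists (Pair p q) => i x.
exact: eval_pair (pa i x) (qb i x).
Qed.

Lemma rec_const c : rec (fun _ _ => c).
Proof.
by elim: c => [|c IH]; [exists Zero => i x; constructor | apply: rec_succ].
Qed.

Lemma rec_comp2 f a b : rec (fun i w => f i (cfst w) (csnd w)) ->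
  rec a -> rec b -> rec (fun i x => f i (a i x) (b i x)).
Proof.
move=> rf ra rb; apply: rec_ext (rec_comp rf (rec_cpair ra rb)) => i x.
by rewrite cfstK csndK.
Qed.

(** Stated for a given function [F] and its recursion equations, so that the values
of the program are the values of [F]; the parameter [y] may be a coded tuple
holding the whole context. *)
Lemma rec_prec (F : I -> nat -> nat -> nat) b s a n :
  (forall i y, F i y 0 = b i y) ->
  (forall i y m, F i y m.+1 = s i y m (F i y m)) ->
  rec b -> rec (fun i w => s i (cfst w) (cfst (csnd w)) (csnd (csnd w))) ->
  rec a -> rec n -> rec (fun i x => F i (a i x) (n i x)).
Proof.
move=> F0 FS [p pb] [q qs]; apply: rec_comp2; exists (Prec p q) => i w.
rewrite -{1}(cpairK w); elim: (csnd w) => [|m IH].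
  by rewrite F0; apply: eval_prec0; apply: pb.
rewrite FS; apply: (eval_precS IH).
have := qs i (cpair (cfst w) (cpair m (F i (cfst w) m))).
by rewrite !(cfstK, csndK).
Qed.

Lemma rec_add a b : rec a -> rec b -> rec (fun i x => a i x + b i x).
Proof.
apply: (@rec_prec (fun _ => addn) (fun _ y => y) (fun _ _ _ v => v.+1)).
- by move=> i y; rewrite addn0.
- by move=> i y m; rewrite addnS.
- exact: rec_id.
- by apply: rec_succ; apply: rec_csnd; apply: rec_csnd; apply: rec_id.
Qed.

Lemma rec_mul a b : rec a -> rec b -> rec (fun i x => a i x * b i x).
Proof.
apply: (@rec_prec (fun _ => muln) (fun _ _ => 0) (fun _ y _ v => y + v)).
- by move=> i y; rewrite muln0.
- by move=> i y m; rewrite mulnS.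
- exact: rec_const.
- apply: rec_add; first by apply: rec_cfst; apply: rec_id.
  by apply: rec_csnd; apply: rec_csnd; apply: rec_id.
Qed.

Lemma rec_exp c b : rec b -> rec (fun i x => c ^ b i x).
Proof.
apply: (@rec_prec (fun _ _ m => c ^ m) (fun _ _ => 1) (fun _ _ _ v => c * v))
  => //.
- by move=> i y m; rewrite expnS.
- exact: rec_const.
- apply: rec_mul; first exact: rec_const.
  by apply: rec_csnd; apply: rec_csnd; apply: rec_id.
- exact: rec_id.
Qed.

Lemma rec_pred a : rec a -> rec (fun i x => (a i x).-1).
Proof.
apply: (@rec_prec (fun _ _ m => m.-1) (fun _ _ => 0) (fun _ _ m _ => m)) => //.
- exact: rec_const.
- by apply: rec_cfst; apply: rec_csnd; apply: rec_id.
- exact: rec_id.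
Qed.

Lemma rec_sub a b : rec a -> rec b -> rec (fun i x => a i x - b i x).
Proof.
apply: (@rec_prec (fun _ => subn) (fun _ y => y) (fun _ _ _ v => v.-1)).
- by move=> i y; rewrite subn0.
- by move=> i y m; rewrite subnS.
- exact: rec_id.
- by apply: rec_pred; apply: rec_csnd; apply: rec_csnd; apply: rec_id.
Qed.

Lemma rec_not P : rec (fun i x => P i x : bool) -> rec (fun i x => ~~ P i x).
Proof.
move=> rP; apply: rec_ext (rec_sub (rec_const 1) rP) => i x.
by case: (P i x).
Qed.

Lemma rec_leq a b : rec a -> rec b -> rec (fun i x => a i x <= b i x).
Proof.
move=> ra rb.
apply: rec_ext (rec_sub (rec_const 1) (rec_sub ra rb)) => i x.
by rewrite -subn_eq0; case: (a i x - b i x).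
Qed.

Lemma rec_and P Q : rec (fun i x => P i x : bool) ->
  rec (fun i x => Q i x : bool) -> rec (fun i x => P i x && Q i x).
Proof.
move=> rP rQ; apply: rec_ext (rec_mul rP rQ) => i x.
by case: (P i x); case: (Q i x).
Qed.

Lemma rec_or P Q : rec (fun i x => P i x : bool) ->
  rec (fun i x => Q i x : bool) -> rec (fun i x => P i x || Q i x).
Proof.
move=> rP rQ; apply: rec_ext (rec_not (rec_and (rec_not rP) (rec_not rQ))).
by move=> i x; rewrite negb_and !negbK.
Qed.

Lemma rec_imp P Q : rec (fun i x => P i x : bool) ->
  rec (fun i x => Q i x : bool) -> rec (fun i x => P i x ==> Q i x).
Proof.
move=> rP rQ; apply: rec_ext (rec_or (rec_not rP) rQ) => i x.
by rewrite implybE.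
Qed.

Lemma rec_eq a b : rec a -> rec b -> rec (fun i x => a i x == b i x).
Proof.
move=> ra rb; apply: rec_ext (rec_and (rec_leq ra rb) (rec_leq rb ra)) => i x.
by rewrite -eqn_leq.
Qed.

Lemma rec_if P a b : rec (fun i x => P i x : bool) -> rec a -> rec b ->
  rec (fun i x => if P i x then a i x else b i x).
Proof.
move=> rP ra rb.
apply: rec_ext (rec_add (rec_mul rP ra) (rec_mul (rec_not rP) rb)) => i x.
by case: (P i x); rewrite ?mul1n ?mul0n ?addn0.
Qed.

Lemma rec_ifb P Q S : rec (fun i x => P i x : bool) ->
  rec (fun i x => Q i x : bool) -> rec (fun i x => S i x : bool) ->
  rec (fun i x => if P i x then Q i x else S i x : bool).
Proof.
move=> rP rQ rS; apply: rec_ext (rec_if rP rQ rS) => i x.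
by case: (P i x).
Qed.

Lemma rec_odd a : rec a -> rec (fun i x => odd (a i x)).
Proof.
apply: (@rec_prec (fun _ _ m => odd m) (fun _ _ => 0) (fun _ _ _ v => 1 - v))
  => //.
- by move=> i y m; rewrite oddS; case: (odd m).
- exact: rec_const.
- apply: rec_sub; first exact: rec_const.
  by apply: rec_csnd; apply: rec_csnd; apply: rec_id.
- exact: rec_id.
Qed.

Lemma rec_iter f a n : rec (fun _ => f) -> rec a -> rec n ->
  rec (fun i x => iter (n i x) f (a i x)).
Proof.
move=> rf; apply: (@rec_prec (fun _ y m => iter m f y) (fun _ y => y)
  (fun _ _ _ v => f v)) => //; first exact: rec_id.
by apply: rec_comp rf _; apply: rec_csnd; apply: rec_csnd; apply: rec_id.
Qed.

Lemma rec_count P n : rec (fun i w => P i (cfst w) (csnd w) : bool) -> rec n ->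
  rec (fun i x => count (P i x) (iota 0 (n i x))).
Proof.
move=> rP; apply: (@rec_prec (fun i y m => count (P i y) (iota 0 m))
  (fun _ _ => 0) (fun i y m v => v + P i y m) _ _ _ _ _ _ rec_id).
- by [].
- by move=> i y m; rewrite -addn1 iotaD count_cat /= add0n addn0.
- exact: rec_const.
- apply: rec_add; first by apply: rec_csnd; apply: rec_csnd; apply: rec_id.
  apply: (rec_comp2 (f := fun i y m => P i y m) rP).
    by apply: rec_cfst; apply: rec_id.
  by apply: rec_cfst; apply: rec_csnd; apply: rec_id.
Qed.

Lemma rec_has P n : rec (fun i w => P i (cfst w) (csnd w) : bool) -> rec n ->
  rec (fun i x => has (P i x) (iota 0 (n i x))).
Proof.
move=> rP rn.
apply: rec_ext (rec_leq (rec_const 1) (rec_count rP rn)) => i x.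
by rewrite has_count.
Qed.

Lemma rec_all P n : rec (fun i w => P i (cfst w) (csnd w) : bool) -> rec n ->
  rec (fun i x => all (P i x) (iota 0 (n i x))).
Proof.
move=> rP rn.
apply: rec_ext (rec_eq (rec_count rP rn) rn) => i x.
by rewrite all_count size_iota.
Qed.

(** The operator [Mu] searches for a zero, hence the negation of [P] is the
program to iterate. *)
Lemma rec_mu (P : I -> nat -> nat -> bool) f :
  rec (fun i w => P i (cfst w) (csnd w)) ->
  (forall i x, P i x (f i x)) ->
  (forall i x m, P i x m -> f i x <= m) -> rec f.
Proof.
move=> rP fP fmin; have [p pP] := rec_not rP; exists (Mu p) => i x.
have E m : eval (o i) p (cpair x m) (~~ P i x m).
  by have := pP i (cpair x m); rewrite cfstK csndK.
apply: (@eval_mu _ _ _ _ (fun=> 0)) => [m lm|]; last first.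
  by have := E (f i x); rewrite fP.
have := E m; suff -> : P i x m = false by [].
by apply: contraTF lm => /fmin; rewrite -leqNgt.
Qed.

(** A table of the values at [0, ..., N] is the iterated pair whose outermost
component is the value at [N]; both projections of 0
are 0, so the number 0 serves as the table of the zero function. *)
Definition look N T z := cfst (iter (N - z) csnd T).

Lemma rec_look N T z : rec N -> rec T -> rec z ->
  rec (fun i x => look (N i x) (T i x) (z i x)).
Proof.
move=> rN rT rz; apply: rec_cfst; apply: rec_iter => //; last exact: rec_sub.
by apply: rec_csnd; apply: rec_id.
Qed.

Fixpoint tab (f : nat -> nat) n :=
  if n is m.+1 then cpair (f m) (tab f m) else 0.

Lemma look_tab f N z : z <= N -> look N (tab f N.+1) z = f z.
Proof.
rewrite /look; elim: N => [|N IH]; first by case: z => //= _; rewrite cfstK.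
rewrite leq_eqVlt => /predU1P[->|lzN]; first by rewrite subnn /= cfstK.
by rewrite subSn // iterSr -/iter [csnd _]/= csndK IH.
Qed.

(** Each row [A i n.+1] is obtained from the whole previous row, which is not an
instance of primitive recursion.  Since [step] only reads entries up to a bound
[N] that stays the same along the recursion, rows may be replaced by their
tables up to [N]; the bound [e + x] works for the value at [(e, x)]. *)
Lemma rec_table (A : I -> nat -> nat -> nat)
    (step : I -> (nat -> nat) -> nat -> nat -> nat) e x :
  (forall i y, A i 0 y = 0) ->
  (forall i n y, A i n.+1 y = step i (A i n) n y) ->
  (forall i N n y B B', n < N -> y <= N -> (forall z, z <= N -> B z = B' z) ->
     step i B n y = step i B' n y) ->
  rec (fun i w => step i (look (cfst (cfst w)) (csnd (cfst w)))
                    (cfst (csnd w)) (csnd (csnd w))) ->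
  rec e -> rec x -> rec (fun i w => A i (e i w) (x i w)).
Proof.
move=> A0 AS loc rstep re rx.
pose T := fun i N => fix T n := if n is m.+1 then
  tab (fun y => step i (look N (T m)) m y) N.+1 else 0.
have TE i N n z : n <= N -> z <= N -> look N (T i N n) z = A i n z.
  elim: n z => [|n IH] z ln lz.
    by rewrite A0 /look /= (_ : iter _ _ _ = 0) //; elim: (N - z) => //= k ->.
  rewrite [T _ _ _]/= -/(tab _ _.+1) look_tab // AS.
  apply: (loc i N) => // z' lz'.
  by apply: IH => //; apply: ltnW.
have rT a n : rec a -> rec n -> rec (fun i w => T i (a i w) (n i w)).
  apply: (@rec_prec T (fun _ _ => 0)
    (fun i N m v => tab (fun y => step i (look N v) m y) N.+1)) => //.
    exact: rec_const.
  apply: (@rec_prec (fun i w k => tab (fun y => step i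
      (look (cfst w) (csnd (csnd w))) (cfst (csnd w)) y) k)
    (fun _ _ => 0) (fun i w k v => cpair (step i
      (look (cfst w) (csnd (csnd w))) (cfst (csnd w)) k) v)
    (fun _ w => w)) => //.
  - exact: rec_const.
  - apply: rec_cpair; last by apply: rec_csnd; apply: rec_csnd; apply: rec_id.
    have r1 := rec_cfst (rec_id); have r2 := rec_csnd (rec_id).
    apply: rec_ext (rec_comp rstep (rec_cpair
      (rec_cpair (rec_cfst r1) (rec_csnd (rec_csnd r1)))
      (rec_cpair (rec_cfst (rec_csnd r1)) (rec_cfst r2)))) => i w.
    by rewrite !(cfstK, csndK).
  - exact: rec_id.
  - by apply: rec_succ; apply: rec_cfst; apply: rec_id.
have rex := rec_add re rx.
apply: rec_ext (rec_look rex (rT _ _ rex re) rx) => i w.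
by rewrite TE ?leq_addr ?leq_addl.
Qed.

End Closure.


(** Decomposes a goal [recursive o f] along the head symbol of the body of [f];
bounded quantifiers turn the context [x] into the pair of [x] and the bound
variable. *)
Ltac rec_step := lazymatch goal with
  | |- recursive _ (fun _ x => x) => apply: rec_id
  | |- recursive _ (fun _ _ => ?c) => exact: rec_const
  | |- recursive _ (fun i x => cfst (@?a i x)) => apply: rec_cfst
  | |- recursive _ (fun i x => csnd (@?a i x)) => apply: rec_csnd
  | |- recursive _ (fun i x => cpair (@?a i x) (@?b i x)) => apply: rec_cpair
  | |- recursive _ (fun i x => (@?a i x).+1) => apply: rec_succ
  | |- recursive _ (fun i x => (@?a i x).-1) => apply: rec_pred
  | |- recursive _ (fun i x => @?a i x + @?b i x) => apply: rec_add
  | |- recursive _ (fun i x => @?a i x * @?b i x) => apply: rec_mul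
  | |- recursive _ (fun i x => _ ^ @?b i x) => apply: rec_exp
  | |- recursive _ (fun i x => look (@?a i x) (@?b i x) (@?c i x)) =>
      apply: rec_look
  | |- recursive _ (fun i x => count (@?P i x) (iota 0 (@?b i x))) =>
      apply: rec_count
  | |- recursive _ (fun i x => nat_of_bool (~~ @?P i x)) => apply: rec_not
  | |- recursive _ (fun i x => nat_of_bool (@?P i x && @?Q i x)) =>
      apply: rec_and
  | |- recursive _ (fun i x => nat_of_bool (@?P i x || @?Q i x)) =>
      apply: rec_or
  | |- recursive _ (fun i x => nat_of_bool (@?P i x ==> @?Q i x)) =>
      apply: rec_imp
  | |- recursive _ (fun i x => nat_of_bool (@?a i x <= @?b i x)) =>
      apply: rec_leq
  | |- recursive _ (fun i x => nat_of_bool (@?a i x == @?b i x)) =>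
      apply: rec_eq
  | |- recursive _ (fun i x => nat_of_bool (odd (@?a i x))) => apply: rec_odd
  | |- recursive _ (fun i x => nat_of_bool (has (@?P i x) (iota 0 (@?b i x)))) =>
      apply: rec_has
  | |- recursive _ (fun i x => nat_of_bool (all (@?P i x) (iota 0 (@?b i x)))) =>
      apply: rec_all
  | |- recursive _ (fun i x => nat_of_bool _) => apply: rec_ifb
  | |- recursive _ _ => apply: rec_if
  end.
Ltac rec_auto := repeat (cbv beta; rec_step).

(** * Properties of almost all numbers *)

Definition eventually (P : nat -> Prop) := exists N, forall n, N <= n -> P n.

Lemma eventually_and P Q :
  eventually P -> eventually Q -> eventually (fun n => P n /\ Q n).
Proof.
move=> [N hP] [N' hQ]; exists (maxn N N') => n.
by rewrite geq_max => /andP[/hP ? /hQ ?].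
Qed.

Lemma eventually_geq m : eventually (fun n => m <= n).
Proof. by exists m. Qed.

Lemma eventually_sub (P Q : nat -> Prop) :
  (forall n, P n -> Q n) -> eventually P -> eventually Q.
Proof. by move=> PQ [N hP]; exists N => n /hP /PQ. Qed.

Lemma eventually_forall_lt (P : nat -> nat -> Prop) k :
  (forall m, m < k -> eventually (P m)) ->
  eventually (fun n => forall m, m < k -> P m n).
Proof.
elim: k => [|k IH] h; first by exists 0.
have h' := IH (fun m lm => h m (ltnW lm)).
apply: eventually_sub (eventually_and h' (h k (ltnSn k))) => n [a b] m.
by rewrite ltnS leq_eqVlt => /predU1P[->|/a].
Qed.

(** * A universal enumeration by stages *)

Definition triple c x y := cpair c (cpair x y).

(** The evaluation of interest has the zero oracle, under which [Oracle] behaves as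
[Zero]. *)
Fixpoint code (p : prog) : nat := match p with
  | Zero | Oracle => cpair 0 0
  | Succ => cpair 1 0
  | Fst => cpair 2 0
  | Snd => cpair 3 0
  | Pair p q => cpair 4 (cpair (code p) (code q))
  | Comp p q => cpair 5 (cpair (code p) (code q))
  | Prec p q => cpair 6 (cpair (code p) (code q))
  | Mu p => cpair 7 (cpair (code p) 0)
  end.

(** One rule of the evaluation relation concludes that the program coded by [c]
maps [x] to [y], from premises in [M].  The intermediate values that a rule
guesses are bounded by [t], which makes this a bounded, hence recursive,
condition. *)
Definition justified (M : nat -> bool) t c x y :=
  let p := cfst (csnd c) in let q := csnd (csnd c) in
  if cfst c == 0 then y == 0 else
  if cfst c == 1 then y == x.+1 else
  if cfst c == 2 then y == cfst x else
  if cfst c == 3 then y == csnd x else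
  if cfst c == 4 then M (triple p x (cfst y)) && M (triple q x (csnd y)) else
  if cfst c == 5 then
    has (fun z => M (triple q x z) && M (triple p z y)) (iota 0 t)
  else if cfst c == 6 then
    if csnd x == 0 then M (triple p (cfst x) y) else
    has (fun z => M (triple c (cpair (cfst x) (csnd x).-1) z) &&
                  M (triple q (cpair (cfst x) (cpair (csnd x).-1 z)) y))
      (iota 0 t)
  else if cfst c == 7 then M (triple p (cpair x y) 0) &&
    all (fun m => has (fun z => M (triple p (cpair x m) z.+1)) (iota 0 t))
      (iota 0 y)
  else false.

(** The restriction to facts [v < t] keeps the process recursive: a stage only
consults a finite table of the previous one. *)
Definition stage_step (S : nat -> nat) t u : nat :=
  (S u != 0) || justified (fun v => (v < t) && (S v != 0)) t
                  (cfst u) (cfst (csnd u)) (csnd (csnd u)).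

Fixpoint stage t := if t is n.+1 then stage_step (stage n) n else fun=> 0.

Lemma rec_stage I (o : I -> nat -> nat) a b : recursive o a -> recursive o b ->
  recursive o (fun i x => stage (a i x) (b i x)).
Proof.
apply: (@rec_table _ _ (fun _ => stage) (fun _ => stage_step)); first by [].
- by move=> i n y; reflexivity.
- move=> _ N t u S S' tN uN SS'; rewrite /stage_step (SS' u uN).
  suff -> : (fun v => (v < t) && (S v != 0)) = (fun v => (v < t) && (S' v != 0))
    by [].
  apply/funext => v; case: ltnP => //= vt.
  by rewrite SS' // ltnW // (ltn_trans vt).
rewrite /stage_step /justified /triple; cbv zeta. rec_auto.
Qed.

Definition known t u := (u < t) && (stage t u != 0).

Lemma stage_mono t t' u : t <= t' -> stage t u != 0 -> stage t' u != 0.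
Proof.
move=> /subnK <-; elim: (t' - t) => //= n IH /IH h.
by rewrite /stage_step h.
Qed.

Lemma stage_justified t u : stage t u != 0 -> exists2 s, s < t &
  justified (known s) s (cfst u) (cfst (csnd u)) (csnd (csnd u)).
Proof.
elim: t => //= t IH; rewrite /stage_step.
case: (eqVneq (stage t u) 0) => [_|/IH [s st js] _]; last first.
  by exists s => //; apply: ltnW.
by rewrite eqb0 negbK => js; exists t.
Qed.

Lemma eventually_known c x y :
  eventually (fun t => justified (known t) t c x y) ->
  eventually (fun t => known t (triple c x y)).
Proof.
move=> [N h]; exists (maxn N.+1 (triple c x y).+1) => t.
rewrite geq_max /known => /andP[Nt ->] /=; apply: stage_mono Nt _.
by rewrite /= /stage_step /triple !(cfstK, csndK) h // orbT.
Qed.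

(** The rule concluding an evaluation applies as soon as all its premises and
guessed values are below the stage; for [Mu] these are finitely many. *)
Lemma known_complete p x y :
  eval (fun=> 0) p x y -> eventually (fun t => known t (triple (code p) x y)).
Proof.
elim => {p x y}.
- move=> x; apply: eventually_known; exists 0 => t _.
  by rewrite /justified cfstK.
- move=> x; apply: eventually_known; exists 0 => t _.
  by rewrite /justified cfstK /=.
- move=> x; apply: eventually_known; exists 0 => t _.
  by rewrite /justified cfstK /=.
- move=> x; apply: eventually_known; exists 0 => t _.
  by rewrite /justified cfstK /=.
- move=> x; apply: eventually_known; exists 0 => t _.
  by rewrite /justified cfstK.
- move=> p q x a b _ h1 _ h2; apply: eventually_known.
  apply: eventually_sub (eventually_and h1 h2) => t [k1 k2].
  by rewrite /justified !(cfstK, csndK) /= k1.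
- move=> p q x z y _ h1 _ h2; apply: eventually_known.
  have := eventually_and (eventually_geq z.+1) (eventually_and h1 h2).
  apply: eventually_sub => t [zt [k1 k2]].
  rewrite /justified !(cfstK, csndK) /=; apply/hasP.
  exists z; last by rewrite k1.
  by rewrite mem_iota.
- move=> p q a y _ h; apply: eventually_known; apply: eventually_sub h => t k.
  by rewrite /justified !(cfstK, csndK).
- move=> p q a n z y _ h1 _ h2; apply: eventually_known.
  have := eventually_and (eventually_geq z.+1) (eventually_and h1 h2).
  apply: eventually_sub => t [zt [k1 k2]].
  rewrite /justified !(cfstK, csndK) /=; apply/hasP.
  exists z; last by rewrite k1.
  by rewrite mem_iota.
- move=> p a n v _ h _ h0; apply: eventually_known.
  have hv m : m < n -> eventually (fun t =>
    has (fun z => known t (triple (code p) (cpair a m) z.+1)) (iota 0 t)).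
    move=> /h h1; have := eventually_and (eventually_geq (v m).+1) h1.
    apply: eventually_sub => t [vt k]; apply/hasP; exists (v m) => //.
    by rewrite mem_iota.
  have := eventually_and h0 (eventually_forall_lt hv).
  apply: eventually_sub => t [k0 kv]; rewrite /justified !(cfstK, csndK) /= k0.
  by apply/allP => m; rewrite mem_iota => /kv.
Qed.

(** Determinism is a property of the rules, so it holds for all numbers [c], coding
a program or not: the last rule used is dictated by [c] and [x], and its premises
have appeared earlier. *)
Lemma stage_deterministic t t' c x y y' :
  stage t (triple c x y) != 0 -> stage t' (triple c x y') != 0 -> y = y'.
Proof.
elim/ltn_ind: t t' c x y y' => t IH t' c x y y' /stage_justified[s st j].
move=> /stage_justified[s' st' j']; move: j j'; rewrite /triple !(cfstK, csndK).
have {IH} D d u v v' :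
    known s (triple d u v) -> known s' (triple d u v') -> v = v'.
  by move=> /andP[_ k] /andP[_ k']; apply: IH st _ _ _ _ _ k k'.
rewrite /justified; do 4 (case: ifP => _; first by move=> /eqP -> /eqP ->).
case: ifP => _.
  move=> /andP[k1 k2] /andP[k1' k2'].
  by rewrite -(cpairK y) -(cpairK y') (D _ _ _ _ k1 k1') (D _ _ _ _ k2 k2').
case: ifP => _.
  move=> /hasP[z _ /andP[k1 k2]] /hasP[z' _ /andP[k1' k2']].
  by move: k2'; rewrite -(D _ _ _ _ k1 k1'); apply: D.
case: ifP => _.
  case: ifP => _; first exact: D.
  move=> /hasP[z _ /andP[k1 k2]] /hasP[z' _ /andP[k1' k2']].
  by move: k2'; rewrite -(D _ _ _ _ k1 k1'); apply: D.
case: ifP => // _ /andP[k0 /allP kv] /andP[k0' /allP kv'].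
have [yy'|yy'|//] := ltngtP y y'.
  have /kv'/hasP[z _ k] : y \in iota 0 y' by rewrite mem_iota.
  by have := D _ _ _ _ k0 k.
have /kv/hasP[z _ k] : y' \in iota 0 y by rewrite mem_iota.
by have := D _ _ _ _ k k0'.
Qed.

Ltac rec_auto_stage := repeat (cbv beta; lazymatch goal with
  | |- recursive _ (fun i x => stage (@?a i x) (@?b i x)) => apply: rec_stage
  | H : recursive ?o (fun _ => ?f) |- recursive ?o (fun i x => ?f (@?a i x)) =>
      apply: (rec_comp H)
  | _ => first [rec_step | apply: (@rec_oracle _ id)]
  end).

(** * The family computed from a function *)

Definition yields e k x t := stage t (triple e x k) != 0.

(** Within [t] steps, the [e]-th partial function is seen to be defined up to [y],
and to take both values above [y] on each atom, where [A] maps a number to the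
index of its atom.  The first conjunct makes the test fail from some [y] on when
the function is partial. *)
Definition test (A : nat -> nat) e y t :=
  all (fun z => yields e 0 z t || yields e 1 z t) (iota 0 y.+1) &&
  all (fun c => all (fun k => has (fun z =>
    [&& y <= z, A z == c & yields e k z t]) (iota 0 t)) (iota 0 2))
    (iota 0 (2 ^ e)).

(** The argument [y] tested at [x].  It tends to infinity with [x], so
finitely many wrong answers of the test spoil finitely many [x] only. *)
Definition last_below (h : nat -> nat) x y :=
  (h y <= x) && all (fun z => (h z <= x) ==> (z <= y)) (iota 0 x.+1).

Definition accepts h A e x :=
  has (fun y => last_below h x y && test A e y (h y)) (iota 0 x.+1).

(** Along each atom the parity alternates, so that it splits every infinite one. *)
Definition parity (A : nat -> nat) x :=
  odd (count (fun z => A z == A x) (iota 0 x)).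

Definition atom_step h (A : nat -> nat) e x : nat :=
  2 * A x + (if accepts h A e x then yields e 1 x (h x) else parity A x).

(** The memberships of [x] in the first [e] sets of the family, as the digits of a
binary number below [2 ^ e], the latest set giving the lowest digit. *)
Fixpoint atom h e := if e is d.+1 then atom_step h (atom h d) d else fun=> 0.

Lemma yields_mono e k x t t' : t <= t' -> yields e k x t -> yields e k x t'.
Proof. exact: stage_mono. Qed.

Lemma yields_deterministic e k k' x t t' :
  yields e k x t -> yields e k' x t' -> k = k'.
Proof. exact: stage_deterministic. Qed.

Lemma test_local A B e y t :
  (forall z, z < t -> A z = B z) -> test A e y t = test B e y t.
Proof.
move=> AB; congr andb; apply: eq_all => c; apply: eq_all => k.
by apply: eq_in_has => z; rewrite mem_iota => /AB ->.
Qed.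

Lemma test_mono A e y t t' : t <= t' -> test A e y t -> test A e y t'.
Proof.
move=> tt' /andP[/allP conv /allP split]; apply/andP; split; apply/allP.
  by move=> z /conv /orP[] /(yields_mono tt') -> //; rewrite orbT.
move=> c /split /allP ac; apply/allP => k /ac /hasP[z].
rewrite mem_iota => zt /and3P[yz Az Vz]; apply/hasP; exists z.
  by rewrite mem_iota; apply: leq_trans zt tt'.
by rewrite yz Az; apply: yields_mono Vz.
Qed.

(** The test at [x] uses [h y <= x] steps and thus only inspects atoms of
numbers below [x]: this is the locality required by table recursion. *)
Lemma rec_atom e x : recursive id e -> recursive id x ->
  recursive id (fun h w => atom h (e h w) (x h w)).
Proof.
apply: (@rec_table _ _ atom atom_step).
- by [].
- by move=> h n y; reflexivity.
- move=> h N n y A B nN yN AB.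
  have AB' z : z <= y -> A z = B z by move=> zy; apply/AB/(leq_trans zy).
  rewrite /atom_step AB'//; congr (_ + nat_of_bool _).
  have -> : parity A y = parity B y.
    rewrite /parity AB'//; congr odd; apply: eq_in_count => z.
    by rewrite mem_iota => zy; rewrite AB' // ltnW.
  suff -> : accepts h A n y = accepts h B n y by [].
  apply: eq_has => z; rewrite /last_below.
  case: leqP => //= hz; congr andb; apply: test_local => v vz.
  by apply: AB'; apply: ltnW; apply: leq_trans hz.
rewrite /atom_step /accepts /last_below /test /parity /yields /triple.
rec_auto_stage.
Qed.

(** * What a dominating function achieves *)

Definition computable_fun f := recursive (fun (_ : unit) _ => 0) (fun _ => f).

Lemma computable_funE f : computable_fun f <-> computable f.
Proof. by split=> [[p pf]|[p pf]]; exists p => // x; apply: (pf tt). Qed.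

Lemma computable_ext_eventually f g :
  eventually (fun n => f n = g n) -> computable_fun f -> computable_fun g.
Proof.
move=> [N]; elim: N g => [|N IH] g fg rf.
  by apply: rec_ext rf => _ x; apply: fg.
have rg := IH (fun n => if n == N then f N else g n) _ rf.
have {}rg : computable_fun (fun n => if n == N then f N else g n).
  apply: rg => n; case: eqP => [->//|/eqP nN] Nn.
  by apply: fg; rewrite ltn_neqAle eq_sym nN.
apply: (@rec_ext _ _ (fun _ n => if n == N then g N
  else if n == N then f N else g n)).
  by move=> _ x; case: eqP => [->|].
by apply: (rec_if _ _ rg); rec_auto_stage.
Qed.

Lemma computable_search (P : nat -> nat -> bool) :
  recursive (fun (_ : unit) _ => 0) (fun _ w => P (cfst w) (csnd w)) ->
  (forall x, exists t, P x t) ->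
  exists2 s, computable_fun s & forall x, P x (s x).
Proof.
move=> rP exP; exists (fun x => ex_minn (exP x)); last first.
  by move=> x; case: ex_minnP.
apply: (rec_mu (P := fun _ => P)) => // _ x; first by case: ex_minnP.
by move=> m Pm; case: ex_minnP => k _; apply.
Qed.

Lemma last_below_exists h x y : y <= x -> h y <= x ->
  exists z, [/\ y <= z, z <= x & last_below h x z].
Proof.
move=> yx hy; pose P z := (z <= x) && (h z <= x).
have exP : exists z, P z by exists y; rewrite /P yx.
have ubP z : P z -> z <= x by case/andP.
have [z /andP[zx hz] zmax] := ex_maxnP exP ubP.
exists z; split => //; first by apply: zmax; rewrite /P yx.
rewrite /last_below hz; apply/allP => v; rewrite mem_iota ltnS => /= vx.
by apply/implyP => hv; apply: zmax; rewrite /P vx.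
Qed.

Section Dominating.
Variable h : nat -> nat.
Hypothesis h_dom : forall f, computable f -> dominates h f.
Hypothesis h_ge : forall s, s <= h s.

(** Domination replaces unbounded search by search up to [h x], with finitely many
failures. *)
Lemma dominates_search (P : nat -> nat -> bool) :
  recursive (fun (_ : unit) _ => 0) (fun _ w => P (cfst w) (csnd w)) ->
  (forall x, exists t, P x t) ->
  (forall x t t', t <= t' -> P x t -> P x t') ->
  eventually (fun x => P x (h x)).
Proof.
move=> rP /(computable_search rP)[s /computable_funE /h_dom sh Ps] mono.
by apply: eventually_sub sh => x /mono; apply.
Qed.

Definition convergent e := forall z, exists t, yields e 0 z t || yields e 1 z t.

Definition splits e := forall c k, c < 2 ^ e -> k < 2 ->
  forall y, exists z t, [/\ y <= z, atom h e z = c & yields e k z t].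

Lemma test_reached e : convergent e -> splits e ->
  forall y, exists t, test (atom h e) e y t.
Proof.
move=> tot spl y.
suff : eventually (fun t => test (atom h e) e y t) by case=> N; exists N; auto.
have tot' : eventually (fun t => forall z, z < y.+1 ->
    yields e 0 z t || yields e 1 z t).
  apply: eventually_forall_lt => z _; have [t Vt] := tot z; exists t => t' tt'.
  by case/orP: Vt => /(yields_mono tt') -> //; rewrite orbT.
have spl' : eventually (fun t => forall c, c < 2 ^ e -> forall k, k < 2 ->
    has (fun z => [&& y <= z, atom h e z == c & yields e k z t]) (iota 0 t)).
  apply: eventually_forall_lt => c ce; apply: eventually_forall_lt => k k2.
  have [z [t [yz az Vz]]] := spl c k ce k2 y; exists (maxn z.+1 t) => t'.
  rewrite geq_max => /andP[zt tt']; apply/hasP; exists z; rewrite ?mem_iota //.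
  by rewrite yz az eqxx; apply: yields_mono Vz.
apply: eventually_sub (eventually_and tot' spl') => t [tt st].
apply/andP; split; apply/allP; first by move=> z; rewrite mem_iota => /tt.
move=> c; rewrite mem_iota => /st sc.
by apply/allP => k; rewrite mem_iota => /sc.
Qed.

Lemma test_fails e : ~ (convergent e /\ splits e) ->
  eventually (fun y => forall t, ~~ test (atom h e) e y t).
Proof.
move=> nts; apply: contrapT => nev; apply: nts; split.
  move=> z; apply: contrapT => nz; apply: nev; exists z => y zy t.
  apply/negP => /andP[/allP/(_ z) + _]; rewrite mem_iota ltnS => /(_ zy) Vz.
  by apply: nz; exists t.
move=> c k ce k2 y; apply: contrapT => nz; apply: nev; exists y => y' yy' t.
apply/negP => /andP[_ /allP/(_ c)]; rewrite mem_iota => /(_ ce) /allP/(_ k).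
rewrite mem_iota => /(_ k2) /hasP[z _ /and3P[yz /eqP az Vz]].
by apply: nz; exists z, t; split => //; apply: leq_trans yz.
Qed.

Lemma eventually_accepts e : computable_fun (atom h e) ->
  convergent e -> splits e -> eventually (accepts h (atom h e) e).
Proof.
move=> ra tot spl.
have [|||N hN] := @dominates_search (test (atom h e) e).
- rewrite /test /yields /triple; rewrite /computable_fun in ra; rec_auto_stage.
- exact: test_reached.
- by move=> x t t'; apply: test_mono.
apply: eventually_sub (eventually_geq (h N)) => x hx.
have [y [Ny yx ly]] := last_below_exists (leq_trans (h_ge N) hx) hx.
by apply/hasP; exists y; rewrite ?mem_iota ?ltnS // ly hN.
Qed.

Lemma eventually_rejects e : ~ (convergent e /\ splits e) ->
  eventually (fun x => ~~ accepts h (atom h e) e x).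
Proof.
move=> /test_fails[N hN].
apply: eventually_sub (eventually_geq (h N)) => x hx.
apply/hasP => -[y _ /andP[/andP[_ /allP/(_ N)]]].
rewrite mem_iota ltnS => /(_ (leq_trans (h_ge N) hx)).
by rewrite hx => /= Ny; apply/negP/hN.
Qed.

Lemma eventually_decided e : convergent e ->
  eventually (fun x => yields e 0 x (h x) || yields e 1 x (h x)).
Proof.
move=> tot.
apply: (dominates_search (P := fun x t => yields e 0 x t || yields e 1 x t)).
- by rewrite /yields /triple; rec_auto_stage.
- exact: tot.
- by move=> x t t' tt' /orP[] /(yields_mono tt') -> //; rewrite orbT.
Qed.

(** In this case the [e]-th set is almost equal to the set decided by the [e]-th
partial function; [k] is the value of the latter at [x]. *)
Lemma atom_split e : computable_fun (atom h e) -> convergent e -> splits e ->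
  eventually (fun x => forall k t, k < 2 -> yields e k x t ->
    atom h e.+1 x = 2 * atom h e x + k).
Proof.
move=> ra tot spl; have ev := eventually_and (eventually_accepts ra tot spl)
  (eventually_decided tot).
apply: eventually_sub ev => x [acc dec] k t k2 Vk.
rewrite /= /atom_step acc; congr (_ + _).
case/orP: dec => Vh; rewrite (yields_deterministic Vk Vh) ?Vh //.
by case: (boolP (yields e 1 x (h x))) => // /(yields_deterministic Vh).
Qed.

Lemma atom_parity e : ~ (convergent e /\ splits e) ->
  eventually (fun x => atom h e.+1 x = 2 * atom h e x + parity (atom h e) x).
Proof.
move=> /eventually_rejects; apply: eventually_sub => x /negbTE rej.
by rewrite /= /atom_step rej.
Qed.

(** The program found depends on which of the two cases holds for each index
below [e], and on the finite error; it is not uniform in [e]. *)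
Lemma computable_atom e : computable_fun (atom h e).
Proof.
elim: e => [|e IH]; first exact: rec_const.
have IH' := IH; rewrite /computable_fun in IH'.
have [[tot spl]|nts] := pselect (convergent e /\ splits e); last first.
  apply: (@computable_ext_eventually (fun x => 2 * atom h e x +
    parity (atom h e) x)).
    by apply: eventually_sub (atom_parity nts) => x ->.
  by rewrite /parity; rewrite /computable_fun; rec_auto_stage.
have [|s rs Vs] := @computable_search
  (fun x t => yields e 0 x t || yields e 1 x t) _ tot.
  by rewrite /yields /triple; rec_auto_stage.
apply: (@computable_ext_eventually
  (fun x => 2 * atom h e x + yields e 1 x (s x))).
  apply: eventually_sub (atom_split IH tot spl) => x ax.
  have := Vs x; case: (boolP (yields e 1 x (s x))) => [V1 _|_].
    by rewrite (ax 1 (s x)).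
  by rewrite orbF => V0; rewrite (ax 0 (s x)).
by rewrite /yields /triple; rewrite /computable_fun in rs *; rec_auto_stage.
Qed.

(** Independence.  A new set that is almost equal to a splitting [R_e] splits every
atom.  Otherwise, if the parity took one value almost everywhere on an infinite
atom, two consecutive elements of this atom would contradict it. *)
Lemma atom_infinite e c N : c < 2 ^ e -> exists2 x, N <= x & atom h e x = c.
Proof.
elim: e c N => [|e IH] c N.
  by rewrite expn0 ltnS leqn0 => /eqP ->; exists N.
rewrite expnS => ce; have c2 : c./2 < 2 ^ e.
  rewrite -(ltn_pmul2l (isT : 0 < 2)) (leq_ltn_trans _ ce) //.
  by rewrite mul2n -{2}(odd_double_half c) leq_addl.
have cE : c = 2 * c./2 + odd c by rewrite mul2n addnC odd_double_half.
have [[tot spl]|nts] := pselect (convergent e /\ splits e).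
  have [M aM] := atom_split (computable_atom e) tot spl.
  have [|z [t [zN az Vz]]] := spl c./2 (odd c) c2 _ (maxn M N).
    by case: (odd c).
  move: zN; rewrite geq_max => /andP[Mz Nz]; exists z => //.
  by rewrite (aM z Mz _ _ _ Vz) ?az //; case: (odd c).
have [M aM] := atom_parity nts.
apply: contrapT => nx.
(* If the digit [odd c] is missing beyond [N], the parity is constantly the other
   one on the atom [c./2]; it must change between two consecutive elements. *)
have par x : maxn M N <= x -> atom h e x = c./2 ->
    parity (atom h e) x = ~~ odd c.
  rewrite geq_max => /andP[Mx Nx] ax.
  case: (eqVneq (parity (atom h e) x) (odd c)) => [pc|]; last first.
    by case: (parity _ _); case: (odd c).
  by case: nx; exists x; rewrite // aM // ax pc -cE.
have [x Nx ax] := IH c./2 (maxn M N) c2.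
have exy : exists y, (x < y) && (atom h e y == c./2).
  by have [y xy ay] := IH c./2 x.+1 c2; exists y; rewrite xy ay eqxx.
have [y /andP[xy /eqP ay] ymin] := ex_minnP exy.
have := par y (leq_trans Nx (ltnW xy)) ay; have := par x Nx ax.
rewrite /parity ax ay -(subnK xy) addnC iotaD count_cat.
rewrite -(addn1 x) iotaD count_cat /= ax eqxx addn0.
rewrite (_ : count _ (iota (0 + (x + 1)) _) = 0).
  by rewrite addn0 oddD /=; case: (odd _); case: (odd c).
apply/eqP; rewrite -leqn0 leqNgt -has_count; apply/hasP => -[z].
rewrite mem_iota add0n addn1 subnKC // => /andP[xz zy] az.
by have := ymin z; rewrite xz az leqNgt zy => /(_ isT).
Qed.

End Dominating.

(** * Maximality of the family *)

Definition family h : set nat := [set w | odd (atom h (csnd w).+1 (cfst w))].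

Lemma columnE h n x : column (family h) n x = odd (atom h n.+1 x).
Proof. by rewrite /column /family /= csndK cfstK. Qed.

Lemma atomS h e x : atom h e.+1 x = 2 * atom h e x + odd (atom h e.+1 x).
Proof.
rewrite /= /atom_step; case: (if _ then _ else _);
  by rewrite oddD oddM.
Qed.

Definition binary (s : seq bool) :=
  foldl (fun c b => 2 * c + nat_of_bool b) 0 s.

Lemma binary_surj e c : c < 2 ^ e -> exists2 s, size s = e & binary s = c.
Proof.
elim: e c => [|e IH] c.
  by rewrite expn0 ltnS leqn0 => /eqP ->; exists [::].
rewrite expnS => ce; have [|s se sc] := IH c./2.
  rewrite -(ltn_pmul2l (isT : 0 < 2)) (leq_ltn_trans _ ce) //.
  by rewrite mul2n -{2}(odd_double_half c) leq_addl.
exists (rcons s (odd c)); first by rewrite size_rcons se.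
by rewrite /binary foldl_rcons -/(binary s) sc addnC mul2n odd_double_half.
Qed.

Lemma binary_lt s : binary s < 2 ^ size s.
Proof.
elim/last_ind: s => // s b IH; rewrite size_rcons expnS /binary foldl_rcons.
apply: (@leq_trans (2 * (binary s).+1)); last by rewrite leq_pmul2l.
by rewrite mulnS addnC ltn_add2r; case: b.
Qed.

Lemma Fstr_rcons F s b : Fstr F (rcons s b) =
  Fstr F s `&` (if b then F (size s) else ~` F (size s)).
Proof.
apply/seteqP; split => x; rewrite /Fstr.
  move=> h; split => [i /= si|].
    by have := h i; rewrite /= size_rcons nth_rcons si ltnS => /(_ (ltnW si)).
  have := h (size s); rewrite /= size_rcons nth_rcons ltnn eqxx.
  by move/(_ (ltnSn _)).
move=> [h hb] i /=; rewrite size_rcons ltnS leq_eqVlt nth_rcons.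
by case/predU1P => [->|si]; rewrite ?ltnn ?eqxx // si; apply: h.
Qed.

Lemma Fstr_atom h s x :
  Fstr (column (family h)) s x <-> atom h (size s) x = binary s.
Proof.
elim/last_ind: s => [|s b IH]; first by split => // _ i.
rewrite Fstr_rcons size_rcons atomS /binary foldl_rcons -/(binary s).
have colE : (if b then column (family h) (size s)
    else ~` column (family h) (size s)) x <-> odd (atom h (size s).+1 x) = b.
  case: b; first by rewrite columnE.
  by rewrite /setC /= columnE; split => [/negP/negbTE//|->].
split=> [[/IH -> /colE ->] //|eq2].
have ob : odd (atom h (size s).+1 x) = b.
  by have := congr1 odd eq2; rewrite !mul2n !oddD !odd_double /= !oddb.
split; last exact/colE.
by apply/IH; move/eqP: eq2; rewrite ob eqn_add2r eqn_pmul2l // => /eqP.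
Qed.

Lemma infinite_unbounded (A : set nat) :
  (forall N, exists2 x, N <= x & A x) -> infinite_set A.
Proof.
move=> unb /finite_seqP[s As]; have [x sx] := unb (\max_(i <- s) i).+1.
rewrite As /= => xs; move: sx; rewrite ltnNge => /negP; apply.
exact: leq_bigmax_seq.
Qed.

Lemma almost_subset_eventually (A B : set nat) :
  eventually (fun x => A x -> B x) -> almost_subset A B.
Proof.
move=> [N AB]; apply: sub_finite_set (finite_II N) => x [Ax nBx] /=.
by rewrite ltnNge; apply/negP => /AB /(_ Ax).
Qed.

Lemma computable_set_index R : computable_set R ->
  exists e, forall x, exists t, yields e (charfun R x) x t.
Proof.
move=> [p pR]; exists (code p) => x; have [N kN] := known_complete (pR x).
by exists N; have /andP[] := kN N (leqnn N).
Qed.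

(** Given a computable [R] with index [e]: if its function splits the first [e] sets,
then the atom outside all these sets and inside the next one is almost contained
in [R].  If not, some atom has no element above a bound [y] where the
characteristic function of [R] takes the value [k]. *)
Lemma family_encodes h : DomFcn h -> encodes_MIS (family h).
Proof.
move=> [h_dom h_ge]; split.
  move=> n; apply/computable_funE; have := computable_atom h_dom h_ge n.+1.
  rewrite /computable_fun => rn.
  apply: rec_ext (rec_odd rn) => _ x.
  by rewrite /charfun /in_mem/= /in_set columnE asboolb.
split.
  move=> s; apply: infinite_unbounded => N.
  have [x Nx ax] := atom_infinite h_dom h_ge N (binary_lt s).
  by exists x => //; apply/Fstr_atom.
move=> R /computable_set_index[e eR].
have R2 x : charfun R x < 2 by rewrite /charfun; case: (_ \in _).
have tot : convergent e.
  move=> x; have [t] := eR x; have := R2 x.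
  by case: (charfun R x) => [|[|//]] _ Vt; exists t; rewrite Vt ?orbT.
have [spl|nspl] := pselect (splits h e).
  exists (rcons (nseq e false) true); left; apply: almost_subset_eventually.
  have := atom_split h_dom h_ge (computable_atom h_dom h_ge e) tot spl.
  apply: eventually_sub => x ax; rewrite Fstr_rcons => -[_].
  rewrite size_nseq columnE; have [t Vt] := eR x.
  rewrite (ax _ _ (R2 x) Vt) oddD oddM /= oddb.
  by rewrite inE.
have [c [k [y [ce k2 nV]]]] : exists c k y, [/\ c < 2 ^ e, k < 2 &
    forall z t, y <= z -> atom h e z = c -> ~ yields e k z t].
  apply: contrapT => nex; apply: nspl => c k ce k2 y.
  apply: contrapT => nz; apply: nex; exists c, k, y; split => // z t yz az Vz.
  by apply: nz; exists z, t.
have [s se sc] := binary_surj ce.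
have nR : eventually (fun x => Fstr (column (family h)) s x ->
    charfun R x <> k).
  exists y => x yx /Fstr_atom; rewrite se sc => ax Rk.
  by have [t] := eR x; rewrite Rk; apply: nV.
exists s; case: k k2 nR {nV} => [|[|//]] _ nR; [left|right];
  apply: almost_subset_eventually; apply: eventually_sub nR => x nR /nR.
  by rewrite /charfun; case: (boolP (x \in R)); rewrite ?inE.
by rewrite /charfun; case: (boolP (x \in R)) => // /negP; rewrite inE.
Qed.

Theorem theorem4p3 : medvedev_le I_class DomFcn.
Proof.
have [p hp] : recursive id (fun h w => odd (atom h (csnd w).+1 (cfst w))).
  by apply: rec_odd; apply: rec_atom; rec_auto_stage.
exists p => h hD; exists (charfun (family h)); split.
  move=> w; have := hp h w; congr (eval _ _ _ (nat_of_bool _)).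
  by rewrite /in_mem /= /in_set /family /= asboolb.
by exists (family h) => //; apply: family_encodes.
Qed.
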